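(* Let $D>4$ and let $B=(B^{\mu\nu}_{ij})$, with $\mu,\nu,i,j\in\{1,\dots,D\}$, be a real array that is antisymmetric in $(\mu,\nu)$ and antisymmetric in $(i,j)$. Assume $B$ is generic, i.e. the linear map from antisymmetric arrays $\theta_{\mu\nu}$ to antisymmetric arrays in $(i,j)$ given by $\theta\mapsto \sum_{\mu,\nu}B^{\mu\nu}_{ij}\theta_{\mu\nu}$ is invertible. Then the following are equivalent: (1) there exist real coefficients $c^{[m]}_{[\alpha]}$ (indexed by multi-indices $[m]=(m_1,\dots,m_{D-4})$ and $[\alpha]=(\alpha_1,\dots,\alpha_{D-4})$) such that for all $[m]$ and all $\mu,\nu,\rho,\sigma$, $$\sum_{i,j,k,l}\epsilon^{m_1\cdots m_{D-4}\,ijkl}\,B^{\mu\nu}_{ij}B^{\rho\sigma}_{kl}=\sum_{\alpha_1,\dots,\alpha_{D-4}}\epsilon^{\alpha_1\cdots\alpha_{D-4}\,\mu\nu\rho\sigma}\,c^{[m]}_{[\alpha]};$$ (2) there exists a real $D\times D$ matrix $(e^\mu_i)$ and a sign such that $B^{\mu\nu}_{ij}=\pm|e|\,e^{[\mu}_i e^{\nu]}_j$ for all $\mu,\nu,i,j$, where $|e|$ is the absolute value of $\det(e^\mu_i)$.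
   Context: $\epsilon$ denotes the totally antisymmetric Levi-Civita symbol in $D$ indices (with $\epsilon^{12\cdots D}=1$). Antisymmetrization brackets denote $e^{[\mu}_i e^{\nu]}_j=\tfrac12(e^\mu_i e^\nu_j-e^\nu_i e^\mu_j)$. (Here $B$ is the value at a point of the $\mathfrak{so}(D)$-valued bivector field of the BF formulation of $D$-dimensional Euclidean gravity; condition (1) is the set of equations obtained by varying the Lagrange multipliers, and (2) says $B$ comes from a frame field.) *)

(* Defs.v *)
From HB Require Import structures.
From mathcomp Require Import all_boot all_order all_algebra.
From mathcomp Require Import reals.
Set Implicit Arguments. Unset Strict Implicit. Unset Printing Implicit Defensive.
Import Order.TTheory GRing.Theory Num.Theory.
Local Open Scope ring_scope.

Section Defs.
Variables (R : realType) (D : nat).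

(* Levi-Civita symbol: eps^{s_0 ... s_{D-1}} = det of the matrix whose k-th row
   is the unit vector e_{s_k}; it is 0 on repeated indices, the permutation
   sign otherwise, and eps^{0 1 ... D-1} = 1. *)
Definition levi (s : 'I_D -> 'I_D) : R :=
  \det (\matrix_(k < D, j < D) ((s k == j)%:R : R)).

Definition levi4 (m : {ffun 'I_(D - 4) -> 'I_D}) (a b c d : 'I_D) : R :=
  levi (fun p : 'I_D => nth a (map m (enum 'I_(D - 4)) ++ [:: a; b; c; d]) p).

Definition antisym (A : 'M[R]_D) : Prop := A^T = - A.

Definition Bmap (B : 'I_D -> 'I_D -> 'I_D -> 'I_D -> R) (th : 'M[R]_D) : 'M[R]_D :=
  \matrix_(i, j) \sum_(mu < D) \sum_(nu < D) B mu nu i j * th mu nu.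

Definition generic (B : 'I_D -> 'I_D -> 'I_D -> 'I_D -> R) : Prop :=
  forall phi : 'M[R]_D, antisym phi ->
    exists! th : 'M[R]_D, antisym th /\ Bmap B th = phi.

End Defs.

(* Main.v *)
Require Import Defs.
From HB Require Import structures.
From mathcomp Require Import all_boot all_order all_algebra.
From mathcomp Require Import perm reals ring lra zify.
Import Order.TTheory GRing.Theory Num.Theory.
Local Open Scope ring_scope.
Set Implicit Arguments. Unset Strict Implicit. Unset Printing Implicit Defensive.

(* (1) => (2). Contracting (1) with the epsilon of the complementary indices shows
   that B^{mu nu} /\ B^{rho sigma} is totally antisymmetric in its four upper
   indices. Hence, for fixed mu, the bivectors B^{mu nu} are decomposable and their
   planes meet pairwise. Pairwise meeting planes either share a line or lie in a
   common 3-space; the latter is excluded by genericity, because 3-space carries only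
   3 < D - 1 independent bivectors. So every B^{mu nu} is divisible by a vector f_mu,
   and B^{mu nu} = lam_{mu nu} f_mu /\ f_nu with (f_mu) a basis. The antisymmetry now
   reads lam_{mu nu} lam_{rho sigma} = lam_{mu rho} lam_{nu sigma} for distinct
   indices, which makes lam_{mu nu} of the form k c_mu c_nu; the c_mu are absorbed in
   f_mu, and |k| by a (D+2)-nd root.
   (2) => (1). With e invertible, the left-hand side is a determinant with last rows
   e^mu, e^nu, e^rho, e^sigma; factoring out e leaves unit vectors there, and
   expanding the first D - 4 rows gives c. *)

(** * Bivectors as antisymmetric matrices, and their exterior product *)

Lemma rV_ind (F : fieldType) n (P : 'rV[F]_n -> Prop) :
  P 0 -> (forall x y, P x -> P y -> P (x + y)) ->
  (forall a x, P x -> P (a *: x)) ->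
  (forall i, P (delta_mx 0 i)) -> forall x, P x.
Proof.
move=> P0 PD PZ Pd x; rewrite (row_sum_delta x).
by apply: big_ind => // i _; apply: PZ.
Qed.

Section Bivectors.
Variables (F : realFieldType) (n : nat).
Implicit Types (X Y Z : 'M[F]_n) (x y z w u v : 'rV[F]_n).

Definition bil X x y : F := (x *m X *m y^T) 0 0.

Definition skew_mx u v : 'M[F]_n := u^T *m v - v^T *m u.

(* Up to a constant factor, the 4-form X /\ Y evaluated at (x, y, z, w). *)
Definition wedge X Y x y z w : F :=
  bil X x y * bil Y z w - bil X x z * bil Y y w + bil X x w * bil Y y z
  + bil Y x y * bil X z w - bil Y x z * bil X y w + bil Y x w * bil X y z.

Lemma bilDl X x x' y : bil X (x + x') y = bil X x y + bil X x' y.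
Proof. by rewrite /bil !mulmxDl mxE. Qed.

Lemma bilDr X x y y' : bil X x (y + y') = bil X x y + bil X x y'.
Proof. by rewrite /bil linearD mulmxDr mxE. Qed.

Lemma bilZl X a x y : bil X (a *: x) y = a * bil X x y.
Proof. by rewrite /bil -!scalemxAl mxE. Qed.

Lemma bilZr X a x y : bil X x (a *: y) = a * bil X x y.
Proof. by rewrite /bil linearZ -scalemxAr mxE. Qed.

Lemma bilmD X Y x y : bil (X + Y) x y = bil X x y + bil Y x y.
Proof. by rewrite /bil mulmxDr mulmxDl mxE. Qed.

Lemma bilmZ a X x y : bil (a *: X) x y = a * bil X x y.
Proof. by rewrite /bil -scalemxAr -scalemxAl mxE. Qed.

Lemma bilm0 x y : bil 0 x y = 0.
Proof. by rewrite /bil mulmx0 mul0mx mxE. Qed.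

Lemma bil_delta_r X x j : bil X x (delta_mx 0 j) = (x *m X) 0 j.
Proof. by rewrite /bil trmx_delta -colE mxE. Qed.

Lemma bil_delta X i j : bil X (delta_mx 0 i) (delta_mx 0 j) = X i j.
Proof. by rewrite bil_delta_r -rowE mxE. Qed.

Lemma skew_mxE u v i j : skew_mx u v i j = u 0 i * v 0 j - v 0 i * u 0 j.
Proof. by rewrite !mxE !big_ord1 !mxE. Qed.

Lemma skew_mxZl a u v : skew_mx (a *: u) v = a *: skew_mx u v.
Proof. by apply/matrixP=> i j; rewrite [RHS]mxE !skew_mxE !mxE; ring. Qed.

Lemma skew_mxZr a u v : skew_mx u (a *: v) = a *: skew_mx u v.
Proof. by apply/matrixP=> i j; rewrite [RHS]mxE !skew_mxE !mxE; ring. Qed.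

Lemma skew_mxvv u : skew_mx u u = 0.
Proof. by rewrite /skew_mx subrr. Qed.

Lemma skew_mxDr u v w : skew_mx u (v + w) = skew_mx u v + skew_mx u w.
Proof. by apply/matrixP=> i j; rewrite [RHS]mxE !skew_mxE !mxE; ring. Qed.

Lemma tr_skew_mx u v : (skew_mx u v)^T = - skew_mx u v.
Proof. by apply/matrixP=> i j; rewrite !mxE !big_ord1 !mxE; ring. Qed.

Lemma bil_skew_mx u v x y :
  bil (skew_mx u v) x y =
  (u *m x^T) 0 0 * (v *m y^T) 0 0 - (v *m x^T) 0 0 * (u *m y^T) 0 0.
Proof.
have E (p q : 'rV[F]_n) :
    (x *m (p^T *m q) *m y^T) 0 0 = (p *m x^T) 0 0 * (q *m y^T) 0 0.
  rewrite mulmxA -mulmxA mxE big_ord1; congr (_ * _).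
  by rewrite -[p in RHS]trmxK -trmx_mul [RHS]mxE.
by rewrite /bil /skew_mx mulmxBr mulmxBl [LHS]mxE [X in _ + X = _]mxE !E.
Qed.

Lemma skew_mx_sub u v m (A : 'M_(m, n)) :
  (u <= A)%MS -> (v <= A)%MS -> (skew_mx u v <= A)%MS.
Proof.
move=> uA vA; rewrite /skew_mx addmx_sub ?eqmx_opp //.
  exact: mulmx_sub.
exact: mulmx_sub.
Qed.

(** By linearity in each argument. Two products are added because antisymmetry under an exchange of
    upper indices says that such a sum vanishes. *)
Lemma wedge_eq0_ext X Y X' Y' :
  (forall p q r s : 'I_n,
     wedge X Y (delta_mx 0 p) (delta_mx 0 q) (delta_mx 0 r) (delta_mx 0 s)
     + wedge X' Y' (delta_mx 0 p) (delta_mx 0 q) (delta_mx 0 r) (delta_mx 0 s)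
     = 0) ->
  forall x y z w, wedge X Y x y z w + wedge X' Y' x y z w = 0.
Proof.
pose T x y z w := wedge X Y x y z w + wedge X' Y' x y z w.
rewrite -/(forall x y z w, T x y z w = 0) => H.
have D1 x x' y z w : T (x + x') y z w = T x y z w + T x' y z w.
  by rewrite /T /wedge !bilDl; ring.
have D2 x y y' z w : T x (y + y') z w = T x y z w + T x y' z w.
  by rewrite /T /wedge !(bilDl, bilDr); ring.
have D3 x y z z' w : T x y (z + z') w = T x y z w + T x y z' w.
  by rewrite /T /wedge !(bilDl, bilDr); ring.
have D4 x y z w w' : T x y z (w + w') = T x y z w + T x y z w'.
  by rewrite /T /wedge !(bilDl, bilDr); ring.
have Z1 a x y z w : T (a *: x) y z w = a * T x y z w.
  by rewrite /T /wedge !bilZl; ring.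
have Z2 a x y z w : T x (a *: y) z w = a * T x y z w.
  by rewrite /T /wedge !(bilZl, bilZr); ring.
have Z3 a x y z w : T x y (a *: z) w = a * T x y z w.
  by rewrite /T /wedge !(bilZl, bilZr); ring.
have Z4 a x y z w : T x y z (a *: w) = a * T x y z w.
  by rewrite /T /wedge !(bilZl, bilZr); ring.
elim/rV_ind => [y z w|x x' Ex Ex' y z w|a x Ex y z w|p].
- by rewrite -(scale0r 0) Z1 mul0r.
- by rewrite D1 Ex Ex' addr0.
- by rewrite Z1 Ex mulr0.
elim/rV_ind => [z w|x x' Ex Ex' z w|a x Ex z w|q].
- by rewrite -(scale0r 0) Z2 mul0r.
- by rewrite D2 Ex Ex' addr0.
- by rewrite Z2 Ex mulr0.
elim/rV_ind => [w|x x' Ex Ex' w|a x Ex w|r].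
- by rewrite -(scale0r 0) Z3 mul0r.
- by rewrite D3 Ex Ex' addr0.
- by rewrite Z3 Ex mulr0.
elim/rV_ind => [|x x' Ex Ex'|a x Ex|s].
- by rewrite -(scale0r 0) Z4 mul0r.
- by rewrite D4 Ex Ex' addr0.
- by rewrite Z4 Ex mulr0.
exact: H.
Qed.

Definition wedge0 X Y := forall x y z w, wedge X Y x y z w = 0.

(** Write [u = w *m Y]. Evaluating Y /\ Y = 0 at w, e_q, e_r, e_s gives u_q Y_rs = u_r Y_qs - u_s
    Y_qr, and it remains to divide by a nonzero u_q. *)
Lemma skew_of_sub Y u :
  wedge0 Y Y -> u != 0 -> (u <= Y)%MS ->
  exists2 v, (v <= Y)%MS & Y = skew_mx u v.
Proof.
move=> sY /rV0Pn[q uq] /submxP[w Eu].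
exists ((u 0 q)^-1 *: row q Y); first by rewrite scalemx_sub ?row_sub.
rewrite skew_mxZr.
apply: (canRL (scalerK uq)); apply/matrixP=> r s.
have := sY w (delta_mx 0 q) (delta_mx 0 r) (delta_mx 0 s).
rewrite /wedge !bil_delta !bil_delta_r -Eu => E.
rewrite [LHS]mxE skew_mxE !mxE; lra.
Qed.

Lemma rank_wedge0 Y : wedge0 Y Y -> (\rank Y <= 2)%N.
Proof.
move=> sY; have [->|Y0] := eqVneq Y 0; first by rewrite mxrank0.
have [] := skew_of_sub sY _ (nz_row_sub Y); rewrite ?nz_row_eq0 // => v _ EY.
have /mxrankS : (Y <= col_mx (nz_row Y) v)%MS.
  by rewrite {1}EY skew_mx_sub // -addsmxE ?addsmxSl ?addsmxSr.
by move/leq_trans; apply; apply: (rank_leq_row (col_mx (nz_row Y) v)).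
Qed.

(* If two of the four arguments of X /\ Y range over ker X, only the product of X and
   the restriction of Y to ker X survives; so Y vanishes on ker X, which puts
   (ker X) Y in both row spaces. *)
Lemma cap_wedge0 X Y :
  X^T = - X -> Y^T = - Y -> X != 0 -> Y != 0 -> wedge0 X Y -> (X :&: Y)%MS != 0.
Proof.
move=> aX aY X0 Y0 W; apply: contraNneq Y0 => cap0.
pose K := cokermx X.
have XK : X *m K = 0 := mulmx_coker X.
have KX : K^T *m X = 0 by rewrite -[X]opprK -aX mulmxN -trmx_mul XK trmx0 oppr0.
have KYK : K^T *m Y *m K = 0.
  apply/matrixP=> a b; rewrite [RHS]mxE.
  have /matrix0Pn[r [s Xrs]] := X0.
  have := W (row a K^T) (row b K^T) (delta_mx 0 r) (delta_mx 0 s).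
  have bX c x : bil X (row c K^T) x = 0.
    by rewrite /bil -row_mul KX row0 mul0mx mxE.
  rewrite /wedge !bX !bil_delta !mul0r !mulr0 !addr0 !subr0 !add0r.
  move/eqP; rewrite mulf_eq0 (negPf Xrs) orbF => /eqP <-.
  rewrite /bil -row_mul tr_row trmxK !mxE.
  by apply: eq_bigr => i _; rewrite !mxE.
have KY0 : K^T *m Y = 0.
  apply/eqP; rewrite -submx0 -cap0 sub_capmx submxMl andbT.
  by rewrite submxE KYK.
rewrite -submx0 -cap0 sub_capmx submx_refl andbT submxE -/K.
by rewrite -[Y]opprK -aY mulNmx -[K]trmxK -trmx_mul KY0 trmx0 oppr0.
Qed.
End Bivectors.

(** * Families of planes that meet pairwise *)

Section Planes.
Variables (F : realFieldType) (n : nat).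
Implicit Types (X Y Z U : 'M[F]_n) (t u v f g : 'rV[F]_n).

Lemma sub_adds_rank2 Y (A B : 'M[F]_n) :
  (\rank Y <= 2)%N -> A != 0 -> B != 0 -> (A :&: B)%MS = 0 ->
  (A <= Y)%MS -> (B <= Y)%MS -> (Y <= A + B)%MS.
Proof.
move=> rY A0 B0 AB0 AY BY.
have ABY : (A + B <= Y)%MS by rewrite addsmx_sub AY.
rewrite -(mxrank_leqif_sup ABY) eqn_leq mxrankS //=.
rewrite (leq_trans rY) // mxrank_disjoint_sum //.
by rewrite -(addn1 1) leq_add // lt0n mxrank_eq0.
Qed.

(** Let L be the line common to [Y i1] and [Y i2]. If some [Y i3] misses L, take U = [Y i1 + Y i2],
    of rank at most 2 + 2 - 1. A plane missing L meets [Y i1] and [Y i2] in different lines, hence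
    lies in U; so does [Y i3]. A plane through L is spanned by L and a line of [Y i3], hence lies in
    U too. *)
Lemma pairwise_meeting_planes (I : finType) (P : pred I) (Y : I -> 'M[F]_n) i1 i2 :
  (forall i, P i -> (\rank (Y i) <= 2)%N) ->
  (forall i j, P i -> P j -> (Y i :&: Y j)%MS != 0) ->
  P i1 -> P i2 -> (\rank (Y i1 :&: Y i2) <= 1)%N ->
  (exists2 f : 'rV[F]_n, f != 0 & forall i, P i -> (f <= Y i)%MS) \/
  (exists2 U : 'M[F]_n, (\rank U <= 3)%N & forall i, P i -> (Y i <= U)%MS).
Proof.
move=> rY capY P1 P2 r12.
pose L := (Y i1 :&: Y i2)%MS; have L0 : L != 0 by apply: capY.
have [LY|] := boolP [forall i, P i ==> (L <= Y i)%MS].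
  left; exists (nz_row L); first by rewrite nz_row_eq0.
  move=> i Pi; apply: submx_trans (nz_row_sub L) _.
  by move/forallP/(_ i): LY; rewrite Pi.
rewrite negb_forall => /existsP[i3]; rewrite negb_imply => /andP[P3 LY3].
right; exists (Y i1 + Y i2)%MS.
  have := mxrank_sum_cap (Y i1) (Y i2); rewrite -/L.
  have : (0 < \rank L)%N by rewrite lt0n mxrank_eq0.
  have := rY _ P1; have := rY _ P2; lia.
have capL i : ~~ (L <= Y i)%MS -> (Y i :&: L)%MS = 0.
  apply: contraNeq => capL0.
  have cL : (Y i :&: L <= L)%MS by apply: capmxSr.
  apply: submx_trans (capmxSl _ L); rewrite -(mxrank_leqif_sup cL).
  rewrite eqn_leq mxrankS //=; apply: leq_trans r12 _.
  by rewrite lt0n mxrank_eq0.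
have notL i : P i -> ~~ (L <= Y i)%MS -> (Y i <= Y i1 + Y i2)%MS.
  move=> Pi /capL capL0.
  apply: (submx_trans (sub_adds_rank2 (A := (Y i :&: Y i1)%MS)
    (B := (Y i :&: Y i2)%MS) (rY _ Pi) (capY _ _ Pi P1) (capY _ _ Pi P2) _
    (capmxSl _ _) (capmxSl _ _))).
    apply/eqP; rewrite -submx0 -capL0 !sub_capmx.
    rewrite (submx_trans (capmxSl _ _) (capmxSl _ _)) /=.
    by rewrite (submx_trans (capmxSl _ _) (capmxSr _ _))
               (submx_trans (capmxSr _ _) (capmxSr _ _)).
  by apply: addsmxS; apply: capmxSr.
move=> i Pi; have [LYi|] := boolP (L <= Y i)%MS; last exact: notL.
apply: (submx_trans (sub_adds_rank2 (A := (Y i :&: Y i3)%MS)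
  (B := L) (rY _ Pi) (capY _ _ Pi P3) L0 _ (capmxSl _ _) LYi)).
  by apply/eqP; rewrite -submx0 -(capL _ LY3) capmxS ?capmxSr.
rewrite addsmx_sub (submx_trans (capmxSr _ _) (notL _ P3 LY3)) /=.
exact: submx_trans (capmxSl _ _) (addsmxSl _ _).
Qed.

(** The rank bound makes the two planes coincide. With a common vector f, X = f /\ g and Y = f /\ h;
    then h = u f + v g gives Y = v X. *)
Lemma skew_proportional X Y :
  wedge0 X X -> wedge0 Y Y -> (1 < \rank (X :&: Y))%N -> exists a, Y = a *: X.
Proof.
move=> sX sY rXY.
have le2 Z : wedge0 Z Z -> (X :&: Y <= Z)%MS -> (Z <= X :&: Y)%MS.
  move=> sZ cZ; rewrite -(mxrank_leqif_sup cZ) eqn_leq mxrankS //=.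
  exact: leq_trans (rank_wedge0 sZ) rXY.
have YX : (Y <= X)%MS := submx_trans (le2 _ sY (capmxSr _ _)) (capmxSl _ _).
have [->|Y0] := eqVneq Y 0; first by exists 0; rewrite scale0r.
have f0 : nz_row Y != 0 by rewrite nz_row_eq0.
have [h hY EY] := skew_of_sub sY f0 (nz_row_sub Y).
have [g _ EX] := skew_of_sub sX f0 (submx_trans (nz_row_sub Y) YX).
have /sub_addsmxP[[u v] /= Eh] : (h <= nz_row Y + g)%MS.
  apply: submx_trans hY (submx_trans YX _); rewrite {1}EX.
  by apply: skew_mx_sub; rewrite ?addsmxSl ?addsmxSr.
exists (v 0 0); rewrite EY {1}EX Eh [u]mx11_scalar [v]mx11_scalar !mul_scalar_mx.
by rewrite skew_mxDr !skew_mxZr skew_mxvv scaler0 add0r !mxE mulr1n.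
Qed.

Lemma antisym3_eq0 (A : 'M[F]_3) :
  A^T = - A -> A 0 1 = 0 -> A 0 2%:R = 0 -> A 1 2%:R = 0 -> A = 0.
Proof.
move=> aA A01 A02 A12.
have AC i j : A i j = - A j i by have := congr1 (fun M : 'M_3 => M j i) aA; rewrite !mxE.
have Aii i : A i i = 0 by have := AC i i; lra.
apply/matrixP=> i j; rewrite mxE.
have cas (k : 'I_3) : [\/ k = 0, k = 1 | k = 2%:R].
  by case: k => [[|[|[|//]]] ?]; [constructor 1|constructor 2|constructor 3];
    apply/val_inj.
by case: (cas i) => ->; case: (cas j) => ->; rewrite ?Aii // AC
  ?A01 ?A02 ?A12 ?oppr0 // AC ?A01 ?A02 ?A12 ?oppr0.
Qed.

(** A bivector of a 3-space has three coordinates; together with t_mu = 0 this makes four linear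
    conditions on more than four unknowns. *)
Lemma dependent_in_rank3 (Y : 'I_n -> 'M[F]_n) mu U :
  (4 < n)%N -> (forall nu, (Y nu)^T = - Y nu) -> (\rank U <= 3)%N ->
  (forall nu, nu != mu -> (Y nu <= U)%MS) ->
  exists t : 'rV[F]_n, [/\ t != 0, t 0 mu = 0 & \sum_nu t 0 nu *: Y nu = 0].
Proof.
move=> n4 aY rU YU.
(* The row space of U is enlarged to the span of exactly three rows, so that coordinates form 3 x 3
   matrices. *)
pose U3 : 'M_(3, n) := pid_mx 3 *m row_ebase U.
have UU3 : (U <= U3)%MS.
  rewrite -{1}[U]mulmx_ebase -mulmxA; apply: mulmx_sub.
  apply/submxP; exists (pid_mx (\rank U)); rewrite mulmxA mul_pid_mx.
  by congr (pid_mx _ *m _); lia.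
have [V VP] : exists V, forall Z, (Z <= U3)%MS -> Z *m V *m U3 = Z.
  by exists (pinvmx U3) => Z; apply: mulmxKpV.
pose Q nu := V^T *m Y nu *m V.
(* One column for t_mu = 0, three for the entries above the diagonal of [Q nu], the coordinate
   matrix of [Y nu]. *)
pose M : 'M_(n, 4) := \matrix_(nu, k)
  [:: (nu == mu)%:R; Q nu 0 1; Q nu 0 2%:R; Q nu 1 2%:R]`_k.
have K0 : kermx M != 0.
  rewrite -mxrank_eq0 mxrank_ker subn_eq0 -ltnNge.
  by apply: leq_ltn_trans (rank_leq_col M) n4.
pose t := nz_row (kermx M).
have tM : t *m M = 0 by apply/sub_kermxP/nz_row_sub.
have tMk k : \sum_nu t 0 nu * M nu k = 0.
  by have := congr1 (fun A : 'rV_4 => A 0 k) tM; rewrite !mxE.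
exists t; have tmu : t 0 mu = 0.
  have := tMk 0; rewrite (bigD1 mu) //= mxE eqxx mulr1 big1 ?addr0 // => nu H.
  by rewrite mxE /= (negPf H) mulr0.
split => //; first by rewrite nz_row_eq0.
set Z := \sum_nu _.
have aZ : Z^T = - Z.
  rewrite /Z linear_sum -sumrN; apply: eq_bigr => nu _.
  by rewrite linearZ /= aY scalerN.
have ZU : (Z <= U3)%MS.
  apply: submx_trans UU3; apply: summx_sub => nu _.
  have [->|H] := eqVneq nu mu; first by rewrite tmu scale0r sub0mx.
  by rewrite scalemx_sub ?YU.
have ZV : Z *m V *m U3 = Z by apply: VP.
(* By antisymmetry the column space of Z lies in the 3-space as well as its row space, so Z is
   determined by its coordinate matrix. *)
suff QZ : V^T *m Z *m V = 0.
  have ZV0 : V^T *m Z = 0.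
    by rewrite -(mul0mx 3 U3) -QZ -{1}ZV !mulmxA.
  by rewrite -ZV -[Z]opprK -aZ mulNmx -{1}[V]trmxK -trmx_mul ZV0 trmx0 oppr0 mul0mx.
have QE i j : (V^T *m Z *m V) i j = \sum_nu t 0 nu * Q nu i j.
  rewrite /Z mulmx_sumr mulmx_suml summxE; apply: eq_bigr => nu _.
  by rewrite -scalemxAr -scalemxAl mxE.
apply: antisym3_eq0.
- by rewrite !trmx_mul trmxK aZ mulNmx mulmxN mulmxA.
- by rewrite QE; apply: etrans _ (tMk (Ordinal (isT : 1 < 4)%N));
     apply: eq_bigr => nu _; rewrite [M _ _]mxE.
- by rewrite QE; apply: etrans _ (tMk (Ordinal (isT : 2 < 4)%N));
     apply: eq_bigr => nu _; rewrite [M _ _]mxE.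
- by rewrite QE; apply: etrans _ (tMk (Ordinal (isT : 3 < 4)%N));
     apply: eq_bigr => nu _; rewrite [M _ _]mxE.
Qed.

Lemma exists_notin (s : seq 'I_n) : (size s < n)%N -> exists i, i \notin s.
Proof.
move=> sn; apply/existsP; rewrite -negb_forall; apply/negP => /forallP H.
have : (#|'I_n| <= size s)%N.
  rewrite (leq_trans _ (card_size s)) //.
  apply/subset_leq_card/subsetP => i _; exact: H.
by rewrite card_ord leqNgt sn.
Qed.

(** The last hypothesis is the independence of the [Y nu] with [nu != mu]; the index [mu] is left
    out because [B mu mu = 0] in the application. Independence rules out the alternative of a common
    3-space. *)
Lemma common_factor (Y : 'I_n -> 'M[F]_n) mu :
  (4 < n)%N -> (forall nu, (Y nu)^T = - Y nu) ->
  (forall nu rho, wedge0 (Y nu) (Y rho)) ->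
  (forall t : 'rV[F]_n, t 0 mu = 0 -> \sum_nu t 0 nu *: Y nu = 0 -> t = 0) ->
  exists2 f : 'rV[F]_n, f != 0 & forall nu, nu != mu -> (f <= Y nu)%MS.
Proof.
move=> n4 aY wY indY.
have sumd nu : \sum_rho (delta_mx 0 nu : 'rV[F]_n) 0 rho *: Y rho = Y nu.
  rewrite (bigD1 nu) //= mxE !eqxx scale1r big1 ?addr0 // => rho H.
  by rewrite mxE eqxx (negPf H) scale0r.
have d0 nu : (delta_mx 0 nu : 'rV[F]_n) != 0.
  by apply/rV0Pn; exists nu; rewrite mxE !eqxx oner_eq0.
have Y0 nu : nu != mu -> Y nu != 0.
  move=> H; apply: contraNneq (d0 nu) => E.
  by apply/eqP/indY; rewrite ?sumd // mxE eq_sym (negPf H) andbF.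
have [i1 ] := @exists_notin [:: mu] (leq_trans (isT : 1 < 5)%N n4).
have [i2 ] := @exists_notin [:: mu; i1] (leq_trans (isT : 2 < 5)%N n4).
rewrite !inE negb_or => /andP[i2m i21] i1m.
have [|||||[f f0 H]|[U rU YU]] :=
    @pairwise_meeting_planes _ (fun nu => nu != mu) Y i1 i2 => //.
- by move=> i _; apply: rank_wedge0.
- by move=> i j Hi Hj; apply: cap_wedge0 => //; apply: Y0.
(* If the planes of i1 and i2 coincided, [Y i2 = a *: Y i1] would be a linear relation. *)
- rewrite leqNgt; apply/negP => /(skew_proportional (wY _ _) (wY _ _))[a E].
  have := indY (delta_mx 0 i2 - a *: delta_mx 0 i1).
  rewrite !mxE !(eq_sym mu) (negPf i1m) (negPf i2m) mulr0 subr0 => /(_ erefl).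
  have -> : \sum_nu (delta_mx 0 i2 - a *: delta_mx 0 i1 : 'rV_n) 0 nu *: Y nu = 0.
    under eq_bigr => nu _ do rewrite [X in X *: _]mxE scalerDl.
    rewrite big_split /= sumd; under eq_bigr => nu _ do
      rewrite mxE [X in - X]mxE scaleNr -scalerA.
    by rewrite sumrN -scaler_sumr sumd E subrr.
  move/(_ erefl)/(congr1 (fun v : 'rV_n => v 0 i2)).
  rewrite !mxE !eqxx (negPf i21) mulr0 subr0 => /eqP.
  by rewrite oner_eq0.
- by exists f.
have [t [/eqP t0 tm E]] := dependent_in_rank3 n4 aY rU YU.
by case: t0; apply: indY.
Qed.

End Planes.

(** * From common vectors of planes to a frame *)

Section Frame.
Variables (F : realFieldType) (n : nat).
Implicit Types (X Y Z U : 'M[F]_n) (t u v f g : 'rV[F]_n).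

Lemma wedge0_sum (I : Type) (r : seq I) (P : pred I) X (Y : I -> 'M[F]_n) :
  (forall i, wedge0 X (Y i)) -> wedge0 X (\sum_(i <- r | P i) Y i).
Proof.
move=> H; apply: (big_ind (wedge0 X)) => // [x y z w|Y1 Y2 W1 W2 x y z w].
  by rewrite /wedge !bilm0; ring.
rewrite -[RHS](addr0 0) -{1}(W1 x y z w) -(W2 x y z w) /wedge !bilmD; ring.
Qed.

Lemma wedge0Z a X Y : wedge0 X Y -> wedge0 X (a *: Y).
Proof.
move=> H x y z w; rewrite -[RHS](mulr0 a) -(H x y z w) /wedge !bilmZ; ring.
Qed.

Lemma wedge0_skew_common f g h : wedge0 (skew_mx f g) (skew_mx f h).
Proof. by move=> x y z w; rewrite /wedge !bil_skew_mx; ring. Qed.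

(** For r, s distinct from p, q and from each other, X /\ e_r /\ e_s at e_p, e_q, e_r, e_s equals
    [X p q]. *)
Lemma wedge_nondegenerate X :
  (3 < n)%N -> (forall u v, wedge0 X (skew_mx u v)) -> X = 0.
Proof.
move=> n3 H; apply/eqP/negPn/negP => /matrix0Pn[p [q Xpq]].
have [r] := exists_notin (s := [:: p; q]) (ltnW n3).
have [s] := exists_notin (s := [:: p; q; r]) n3.
rewrite !inE !negb_or => /and3P[sp sq sr] /andP[rp rq].
have := H (delta_mx 0 r) (delta_mx 0 s)
  (delta_mx 0 p) (delta_mx 0 q) (delta_mx 0 r) (delta_mx 0 s).
rewrite /wedge !bil_delta !skew_mxE !mxE !eqxx !(eq_sym p) !(eq_sym q) (eq_sym r).
rewrite (negPf sp) (negPf sq) (negPf sr) (negPf rp) (negPf rq) /= => E.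
by case/eqP: Xpq; rewrite -[RHS]E; ring.
Qed.

Lemma skew_two_factors Y f g :
  Y != 0 -> wedge0 Y Y -> f != 0 -> (f <= Y)%MS -> (g <= Y)%MS ->
  (exists a, g = a *: f) \/ (exists a, Y = a *: skew_mx f g).
Proof.
move=> Y0 sY f0 fY gY; have [h hY EY] := skew_of_sub sY f0 fY.
have /sub_addsmxP[[u v] /= Eg] : (g <= f + h)%MS.
  by apply: submx_trans gY _; rewrite EY skew_mx_sub ?addsmxSl ?addsmxSr.
move: Eg; rewrite [u]mx11_scalar [v]mx11_scalar !mul_scalar_mx => Eg.
have [v0|v0] := eqVneq (v 0 0) 0.
  by left; exists (u 0 0); rewrite Eg v0 scale0r addr0.
right; exists (v 0 0)^-1; rewrite Eg skew_mxDr !skew_mxZr skew_mxvv scaler0 add0r.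
by rewrite scalerA mulVf // scale1r.
Qed.

Variable (B : 'I_n -> 'I_n -> 'M[F]_n).
Hypothesis n4 : (4 < n)%N.
Hypothesis aB : forall mu nu, (B mu nu)^T = - B mu nu.
Hypothesis BC : forall mu nu, B mu nu = - B nu mu.
(** This exchange of the middle indices, together with [BC], generates total antisymmetry in all
    four. *)
Hypothesis wedgeB : forall mu nu rho sg x y z w,
  wedge (B mu nu) (B rho sg) x y z w + wedge (B mu rho) (B nu sg) x y z w = 0.
Hypothesis injB : forall th : 'M[F]_n, th^T = - th ->
  \sum_mu \sum_nu th mu nu *: B mu nu = 0 -> th = 0.
Hypothesis surjB : forall phi : 'M[F]_n, phi^T = - phi ->
  exists th : 'M[F]_n, \sum_mu \sum_nu th mu nu *: B mu nu = phi.

Let Bxx mu : B mu mu = 0.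
Proof.
apply/matrixP=> i j; rewrite mxE.
by have := congr1 (fun M : 'M_n => M i j) (BC mu mu); rewrite mxE; lra.
Qed.

(** A repeated first index in [wedgeB] leaves only this product, since [B mu mu = 0]. For [nu = rho]
    it says that [B mu nu] is decomposable. *)
Let wB mu nu rho : wedge0 (B mu nu) (B mu rho).
Proof.
move=> x y z w; have := wedgeB mu mu nu rho x y z w.
by rewrite Bxx {1}/wedge !bilm0 !(mul0r, mulr0) !(addr0, subr0) add0r.
Qed.

(** Injectivity is applied to e_mu /\ t, whose image is twice the given sum; its row mu is t because
    t_mu = 0. *)
Let indB mu (t : 'rV[F]_n) : t 0 mu = 0 -> \sum_nu t 0 nu *: B mu nu = 0 -> t = 0.
Proof.
move=> tm E; have := injB (tr_skew_mx (delta_mx 0 mu) t) _.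
have -> : \sum_i \sum_j skew_mx (delta_mx 0 mu) t i j *: B i j = 0.
  under eq_bigr => i _ do under eq_bigr => j _ do rewrite skew_mxE scalerBl.
  under eq_bigr => i _ do rewrite big_split.
  rewrite big_split /= (bigD1 mu) //= [X in _ + X + _]big1 ?addr0; last first.
    move=> i H; rewrite big1 // => j _.
    by rewrite mxE eqxx (negPf H) mul0r scale0r.
  under eq_bigr => j _ do rewrite mxE !eqxx mul1r.
  rewrite E add0r exchange_big /= (bigD1 mu) //= [X in _ + X]big1 ?addr0; last first.
    move=> i H; rewrite big1 // => j _.
    by rewrite mxE eqxx (negPf H) mulr0 scale0r oppr0.
  rewrite -[RHS]E; apply: eq_bigr => j _.
  by rewrite mxE !eqxx mulr1 BC scalerN opprK.
move=> /(_ erefl) E0; apply/rowP=> j.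
have := congr1 (fun M : 'M_n => M mu j) E0.
by rewrite skew_mxE tm !mxE !eqxx mul1r mul0r subr0.
Qed.

Let B0 mu nu : mu != nu -> B mu nu != 0.
Proof.
move=> H; apply/eqP => E; have := @indB mu (delta_mx 0 nu).
rewrite mxE (negPf H) andbF (bigD1 nu) //= E scaler0 add0r big1 => [|i Hi].
  move/(_ erefl erefl)/(congr1 (fun v : 'rV_n => v 0 nu))/eqP.
  by rewrite !mxE !eqxx oner_eq0.
by rewrite mxE (negPf Hi) andbF scale0r.
Qed.

Lemma pairwise_frame : exists (f : 'I_n -> 'rV[F]_n) (lam : 'I_n -> 'I_n -> F),
  forall mu nu, B mu nu = lam mu nu *: skew_mx (f mu) (f nu).
Proof.
have /fin_all_exists2[f f0 fB] mu :
    exists2 f : 'rV[F]_n, f != 0 & forall nu, nu != mu -> (f <= B mu nu)%MS.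
  by apply: common_factor => // t; apply: indB.
have fg mu nu : exists g, B mu nu = skew_mx (f mu) g.
  have [->|H] := eqVneq nu mu.
    by exists 0; rewrite Bxx /skew_mx trmx0 mulmx0 mul0mx subr0.
  by have [g _ ->] := skew_of_sub (@wB mu nu nu) (f0 mu) (fB _ _ H); exists g.
exists f; have /fin_all_exists[lam lamE] : forall mu, exists l : 'I_n -> F,
    forall nu, B mu nu = l nu *: skew_mx (f mu) (f nu); last by exists lam.
move=> mu; suff /fin_all_exists[l lE] :
  forall nu, exists l, B mu nu = l *: skew_mx (f mu) (f nu) by exists l.
move=> nu.
have [<-|H] := eqVneq mu nu; first by exists 0; rewrite Bxx scale0r.
have fnu : (f nu <= B mu nu)%MS.
  by rewrite BC eqmx_opp fB.
have fmu : (f mu <= B mu nu)%MS by apply: fB; rewrite eq_sym.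
have [[a E]|//] := skew_two_factors (B0 H) (@wB mu nu nu) (f0 mu) fmu fnu.
(* Parallel [f mu] and [f nu] are impossible: [B mu rho] and [B nu sg] would share a factor, so
   [wedgeB] would make [B mu nu] annihilate every [B rho sg]. These span all bivectors, whence
   [B mu nu = 0]. *)
case/eqP: (B0 H); apply: wedge_nondegenerate (ltnW n4) _ => u v.
have [th <-] := surjB (tr_skew_mx u v).
apply: wedge0_sum => rho; apply: wedge0_sum => sg; apply: wedge0Z => x y z w.
have := wedgeB mu nu rho sg x y z w.
have [g ->] := fg mu rho; have [h ->] := fg nu sg.
have -> : skew_mx (f nu) h = skew_mx (f mu) (a *: h).
  by rewrite E skew_mxZl skew_mxZr.
by rewrite [X in _ + X](wedge0_skew_common _ _ _ x y z w) addr0.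
Qed.

Lemma frame_exists : exists (H : 'M[F]_n) (k : F),
  [/\ H \in unitmx, k != 0 &
      forall mu nu, B mu nu = k *: skew_mx (row mu H) (row nu H)].
Proof.
have [f [lam BE]] := pairwise_frame.
pose M : 'M_n := \matrix_mu f mu.
have fM mu : f mu = row mu M by rewrite rowK.
(* A nonzero v orthogonal to every [f mu] would be annihilated by all bivectors, but e_p /\ e_q does
   not annihilate it when v_p is nonzero. *)
have uM : M \in unitmx.
  rewrite unitmxE unitfE -det_tr; apply/negP => /det0P[v /rV0Pn[p vp] vM].
  have fv mu : f mu *m v^T = 0.
    by rewrite fM -row_mul -[M]trmxK -trmx_mul vM trmx0 row0.
  have [q] := exists_notin (s := [:: p]) (ltn_trans (isT : 1 < 4)%N n4).
  rewrite inE => qp.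
  have [th E] := surjB (tr_skew_mx (delta_mx 0 p) (delta_mx 0 q)).
  have : bil (skew_mx (delta_mx 0 p) (delta_mx 0 q)) (delta_mx 0 q) v = 0.
    rewrite /bil -E -mulmxA mulmx_suml big1 ?mulmx0 ?mxE // => mu _.
    rewrite mulmx_suml big1 // => nu _.
    by rewrite BE -!scalemxAl mulmxBl -!mulmxA !fv !mulmx0 subrr !scaler0.
  rewrite bil_skew_mx !trmx_delta !mul_delta_mx_cond -!rowE !mxE !eqxx.
  rewrite (eq_sym p) (negPf qp) mulr0n mulr1n !mxE eqxx mul0r mul1r sub0r.
  by move/eqP; rewrite oppr_eq0; exact/negP.
(* The dual basis of f, on which [B mu nu] evaluates to its coefficient [lam mu nu]. *)
pose g mu : 'rV_n := (col mu (invmx M))^T.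
have fg mu nu : (f mu *m (g nu)^T) 0 0 = (mu == nu)%:R.
  rewrite /g trmxK fM; transitivity ((M *m invmx M) mu nu).
    by rewrite [LHS]mxE [RHS]mxE; apply: eq_bigr => i _; rewrite mxE [in X in _ * X]mxE.
  by rewrite mulmxV // mxE.
have bilg mu nu i j : bil (B mu nu) (g i) (g j) =
    lam mu nu * ((mu == i)%:R * (nu == j)%:R - (nu == i)%:R * (mu == j)%:R).
  by rewrite BE bilmZ bil_skew_mx !fg.
have quad i j k l : uniq [:: i; j; k; l] ->
    lam i j * lam k l = lam i k * lam j l.
  rewrite /= !inE !negb_or => /and4P[/and3P[ij ik il] /andP[jk jl] kl _].
  have := wedgeB i j k l (g i) (g j) (g k) (g l).
  rewrite /wedge !bilg !eqxx !(eq_sym j) !(eq_sym k) !(eq_sym l).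
  rewrite (negPf ij) (negPf ik) (negPf il) (negPf jk) (negPf jl) (negPf kl) /=.
  by move=> E; apply/eqP; rewrite -subr_eq0 -[X in _ == X]E; apply/eqP; ring.
have lam0 i j : i != j -> lam i j != 0.
  by move=> ij; apply: contraNneq (B0 ij) => E; rewrite BE E scale0r.
have lamC i j : lam i j = lam j i \/ i = j.
  have [->|ij] := eqVneq i j; [by right | left].
  have := bilg i j i j; rewrite BC -scaleN1r bilmZ bilg !eqxx !(eq_sym j) (negPf ij) /=.
  by move=> E; apply/eqP; rewrite -subr_eq0; apply/eqP; lra.
have {}lamC i j : lam i j = lam j i by case: (lamC i j) => [//|->].
have [i0 _] := exists_notin (s := [::]) (ltn_trans (isT : 0 < 4)%N n4).
have [i1] := exists_notin (s := [:: i0]) (ltn_trans (isT : 1 < 4)%N n4).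
have [i2] := exists_notin (s := [:: i0; i1]) (ltn_trans (isT : 2 < 4)%N n4).
rewrite !inE negb_or => /andP[i20 i21] i10.
(* If [lam i j = k * c i * c j] with [c i0 = 1], then [lam i0 i = k * c i] and this ratio equals k.
   So k must be its common value, and [c i] must be [lam i0 i / k]. *)
pose T i j := lam i0 i * lam i0 j / lam i j.
have TC i j : T i j = T j i by rewrite /T (lamC i j) [lam i0 i * _]mulrC.
have Tstep i j k : i != i0 -> j != i0 -> k != i0 -> i != j -> i != k -> T i j = T i k.
  move=> i_0 j0 k0 ij ik; have [->//|jk] := eqVneq j k.
  apply/eqP; rewrite eqr_div ?lam0 //; apply/eqP.
  have : lam i0 j * lam k i = lam i0 k * lam j i.
    by apply: quad; rewrite /= !inE !negb_or !(eq_sym i0) j0 k0 i_0 jk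
      !(eq_sym _ i) ij ik.
  rewrite !(lamC _ i) => E.
  by rewrite -!mulrA E.
pose k := T i1 i2.
have k0 : k != 0 by rewrite !mulf_neq0 ?invr_eq0 ?lam0 // 1?eq_sym.
(* The pair i, j is moved to i1, i2 by replacing one index at a time. *)
have Tk i j : i != i0 -> j != i0 -> i != j -> T i j = k.
  move=> i_0 j0 ij; have [E|i1'] := eqVneq i i1.
    by rewrite E in i_0 ij *; apply: Tstep => //; rewrite eq_sym.
  rewrite (Tstep _ _ i1) // TC; apply: Tstep; rewrite // eq_sym //.
pose c i := if i == i0 then 1 else lam i0 i / k.
have c0 i : c i != 0.
  rewrite /c; case: (eqVneq i i0) => [_|i_0]; first exact: oner_neq0.
  by rewrite mulf_neq0 ?invr_eq0 ?lam0 // eq_sym.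
have lamE i j : i != j -> lam i j = k * c i * c j.
  rewrite /c => ij; case: (eqVneq i i0) ij => [->|i_0]; case: (eqVneq j i0) => [->|j0] ij.
  - by [].
  - by field.
  - by rewrite lamC; field.
  - apply: (mulfI k0); rewrite -{1}(Tk i j) // /T; field.
    by rewrite k0 lam0.
exists (diag_mx (\row_i c i) *m M), k; split=> //.
  rewrite unitmx_mul uM andbT unitmxE unitfE det_diag; apply/prodf_neq0 => i _.
  by rewrite mxE.
have rowH i : row i (diag_mx (\row_i c i) *m M) = c i *: f i.
  by apply/rowP=> j; rewrite fM mul_diag_mx !mxE.
move=> mu nu; rewrite !rowH skew_mxZl skew_mxZr !scalerA BE.
have [->|mn] := eqVneq mu nu; first by rewrite skew_mxvv !scaler0.
by rewrite lamE.
Qed.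

End Frame.

(** * Determinants with four distinguished last rows *)

Section Determinants.
Variable R : comNzRingType.

(** Laplace expansion along the first two rows; its six terms match those of [wedge]. *)
Lemma det_mx44 (A : 'M[R]_4) (i0 := @Ordinal 4 0 isT) (i1 := @Ordinal 4 1 isT)
    (i2 := @Ordinal 4 2 isT) (i3 := @Ordinal 4 3 isT)
    (m := fun a b => A i0 a * A i1 b - A i0 b * A i1 a)
    (m' := fun a b => A i2 a * A i3 b - A i2 b * A i3 a) :
  \det A = m i0 i1 * m' i2 i3 - m i0 i2 * m' i1 i3 + m i0 i3 * m' i1 i2
         + m i1 i2 * m' i0 i3 - m i1 i3 * m' i0 i2 + m i2 i3 * m' i0 i1.
Proof.
(* With entries indexed by natural numbers, the indices produced by the cofactor expansions reduce
   by computation and [ring] can identify them. *)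
have [a AE] : exists a : nat -> nat -> R, A = \matrix_(i < 4, j < 4) a i j.
  exists (fun i j => A (inord i) (inord j)).
  by apply/matrixP=> i j; rewrite mxE !inord_val.
rewrite /m /m' {m m'} AE {AE}.
rewrite (expand_det_row _ 0) !big_ord_recl big_ord0 /cofactor.
do 2!rewrite !(expand_det_row _ 0) !big_ord_recl !big_ord0 /cofactor.
rewrite !det_mx11 !mxE /= /bump /=.
ring.
Qed.

Definition row4 n (u v w x : 'rV[R]_n) : 'M[R]_(4, n) :=
  \matrix_(q < 4) nth 0 [:: u; v; w; x] q.

Definition select k n (m : 'I_k -> 'I_n) : 'M[R]_(k, n) :=
  \matrix_(q < k) delta_mx 0 (m q).

Lemma det_col_mx_swap k n (A : 'M[R]_(k, k + n)) (C : 'M[R]_(n, k + n)) i j :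
  i != j -> \det (col_mx A (xrow i j C)) = - \det (col_mx A C).
Proof.
move=> ij; rewrite xrowE.
have -> : col_mx A (tperm_mx i j *m C) =
    block_mx 1%:M 0 0 (tperm_mx i j) *m col_mx A C.
  by rewrite mul_block_col mul1mx !mul0mx addr0 add0r.
by rewrite det_mulmx det_ublock det1 mul1r det_perm odd_tperm ij expr1 mulN1r.
Qed.

Lemma det_col_mxE k n (A : 'M[R]_(k, k + n)) (C : 'M[R]_(n, k + n)) :
  \det (col_mx A C) = \sum_(s : 'S_(k + n))
    (-1) ^+ s * \prod_q A q (s (lshift n q)) * \prod_q C q (s (rshift k q)).
Proof.
apply: eq_bigr => s _; rewrite big_split_ord mulrA.
congr (_ * _ * _); apply: eq_bigr => q _; first by rewrite col_mxEu.
by rewrite col_mxEd.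
Qed.

(** Linearity in each top row: [m q] is the unit vector chosen in row q. In the converse direction
    this sum supplies the coefficients c. *)
Lemma det_expand_top k n (A : 'M[R]_(k, k + n)) (C : 'M[R]_(n, k + n)) :
  \det (col_mx A C) = \sum_(m : {ffun 'I_k -> 'I_(k + n)})
    \det (col_mx (select m) C) * \prod_q A q (m q).
Proof.
rewrite det_col_mxE; under [RHS]eq_bigr => m _ do rewrite det_col_mxE big_distrl.
rewrite exchange_big /=; apply: eq_bigr => s _.
have -> : \prod_q A q (s (lshift n q)) =
    \prod_q \sum_j (s (lshift n q) == j)%:R * A q j.
  apply: eq_bigr => q _; rewrite (bigD1 (s (lshift n q))) //= eqxx mul1r.
  by rewrite big1 ?addr0 // => j /negPf; rewrite eq_sym => ->; rewrite mul0r.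
rewrite bigA_distr_bigA /= big_distrr big_distrl; apply: eq_bigr => m _ /=.
rewrite big_split /=; under [\prod_q select m _ _]eq_bigr => q _ do rewrite !mxE eqxx /=.
by rewrite !mulrA mulrAC.
Qed.

Definition det4 k (A : 'M[R]_(k, k + 4)) (u v w x : 'rV[R]_(k + 4)) : R :=
  \det (col_mx A (row4 u v w x)).

(** The Leibniz formula with the four rows isolated, so that linearity in each can be read off
    termwise. *)
Lemma det4E k (A : 'M[R]_(k, k + 4)) : exists (c : 'S_(k + 4) -> R) r0 r1 r2 r3,
  forall u v w x : 'rV[R]_(k + 4), det4 A u v w x =
    \sum_(s : 'S_(k + 4)) c s * u 0 (s r0) * v 0 (s r1) * w 0 (s r2) * x 0 (s r3).
Proof.
exists (fun s : 'S_(k + 4) => (-1) ^+ s * \prod_q A q (s (lshift 4 q))).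
exists (rshift k (@Ordinal 4 0 isT)), (rshift k (@Ordinal 4 1 isT)).
exists (rshift k (@Ordinal 4 2 isT)), (rshift k (@Ordinal 4 3 isT)).
move=> u v w x; rewrite /det4 det_col_mxE; apply: eq_bigr => s _.
rewrite !big_ord_recl big_ord0 mulr1 !mxE /= !mulrA.
by do !congr (_ * _); congr (fun_of_matrix _ _ (s _)); apply/val_inj.
Qed.

Lemma det4_multilinear k (A : 'M[R]_(k, k + 4)) (u v w x : 'rV[R]_(k + 4)) :
  \sum_a \sum_b \sum_c \sum_d
    det4 A (delta_mx 0 a) (delta_mx 0 b) (delta_mx 0 c) (delta_mx 0 d)
      * u 0 a * v 0 b * w 0 c * x 0 d = det4 A u v w x.
Proof.
have [c [r0 [r1 [r2 [r3 E]]]]] := det4E A.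
have pick (g : 'rV[R]_(k + 4) -> R) G h (y : 'rV_(k + 4)) :
    (forall z, g z = \sum_(s : 'S_(k + 4)) G s * z 0 (h s)) ->
    \sum_a g (delta_mx 0 a) * y 0 a = g y.
  move=> gE; under eq_bigr => a _ do rewrite gE big_distrl.
  rewrite gE exchange_big; apply: eq_bigr => s _ /=.
  rewrite (bigD1 (h s)) //= mxE !eqxx mulr1 big1 ?addr0 // => a /negPf H.
  by rewrite mxE [h s == a]eq_sym H andbF mulr0 mul0r.
have E4 y1 y2 y3 : \sum_d det4 A y1 y2 y3 (delta_mx 0 d) * x 0 d = det4 A y1 y2 y3 x.
  by apply: (pick _ _ (fun s => s r3)) => z; rewrite E.
have E3 y1 y2 y4 : \sum_d det4 A y1 y2 (delta_mx 0 d) y4 * w 0 d = det4 A y1 y2 w y4.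
  apply: (pick (det4 A y1 y2 ^~ y4)
    (fun s => c s * y1 0 (s r0) * y2 0 (s r1) * y4 0 (s r3)) (fun s => s r2)) => z.
  by rewrite E; apply: eq_bigr => s _; ring.
have E2 y1 y3 y4 : \sum_d det4 A y1 (delta_mx 0 d) y3 y4 * v 0 d = det4 A y1 v y3 y4.
  apply: (pick (fun z => det4 A y1 z y3 y4)
    (fun s => c s * y1 0 (s r0) * y3 0 (s r2) * y4 0 (s r3)) (fun s => s r1)) => z.
  by rewrite E; apply: eq_bigr => s _; ring.
have E1 y2 y3 y4 : \sum_d det4 A (delta_mx 0 d) y2 y3 y4 * u 0 d = det4 A u y2 y3 y4.
  apply: (pick (fun z => det4 A z y2 y3 y4)
    (fun s => c s * y2 0 (s r1) * y3 0 (s r2) * y4 0 (s r3)) (fun s => s r0)) => z.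
  by rewrite E; apply: eq_bigr => s _; ring.
rewrite -E1; apply: eq_bigr => a _.
rewrite -E2 big_distrl; apply: eq_bigr => b _ /=.
rewrite -E3 !big_distrl; apply: eq_bigr => e _ /=.
rewrite -E4 !big_distrl; apply: eq_bigr => d _ /=.
ring.
Qed.

End Determinants.

(** * Identities for the Levi-Civita symbol *)

Section Epsilon.
Variable R : realType.

(** [levi4] with the number k of leading indices freed from D, so that D = k + 4 can be substituted
    and block matrices apply. *)
Definition eps k D (m : {ffun 'I_k -> 'I_D}) (a b c d : 'I_D) : R :=
  levi R (fun p : 'I_D => nth a (map m (enum 'I_k) ++ [:: a; b; c; d]) p).

Lemma eps_det4 k (m : {ffun 'I_k -> 'I_(k + 4)}) a b c d :
  eps m a b c d = det4 (select R m)
    (delta_mx 0 a) (delta_mx 0 b) (delta_mx 0 c) (delta_mx 0 d).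
Proof.
congr (\det _); apply/matrixP=> p j; rewrite !mxE.
case: split_ordP => q ->; rewrite !mxE nth_cat size_map size_enum_ord /=.
  rewrite ltn_ord (nth_map q) ?size_enum_ord // nth_ord_enum.
  by rewrite eq_sym.
rewrite ltnNge leq_addr /= addKn.
by case: q => [[|[|[|[|//]]]] ?] /=; rewrite mxE eqxx eq_sym.
Qed.

Lemma eps_swap01 k D (m : {ffun 'I_k -> 'I_D}) a b c d :
  D = (k + 4)%N -> eps m b a c d = - eps m a b c d.
Proof.
move=> E; subst D; rewrite !eps_det4 /det4.
rewrite -(@det_col_mx_swap _ _ _ _ _ (@Ordinal 4 0 isT) (@Ordinal 4 1 isT)) //.
congr (\det (col_mx _ _)); apply/matrixP=> i j; rewrite !mxE permE.
by case: i => [[|[|[|[|//]]]] ?].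
Qed.

Lemma eps_swap12 k D (m : {ffun 'I_k -> 'I_D}) a b c d :
  D = (k + 4)%N -> eps m a c b d = - eps m a b c d.
Proof.
move=> E; subst D; rewrite !eps_det4 /det4.
rewrite -(@det_col_mx_swap _ _ _ _ _ (@Ordinal 4 1 isT) (@Ordinal 4 2 isT)) //.
congr (\det (col_mx _ _)); apply/matrixP=> i j; rewrite !mxE permE.
by case: i => [[|[|[|[|//]]]] ?].
Qed.

Lemma eps_swap23 k D (m : {ffun 'I_k -> 'I_D}) a b c d :
  D = (k + 4)%N -> eps m a b d c = - eps m a b c d.
Proof.
move=> E; subst D; rewrite !eps_det4 /det4.
rewrite -(@det_col_mx_swap _ _ _ _ _ (@Ordinal 4 2 isT) (@Ordinal 4 3 isT)) //.
congr (\det (col_mx _ _)); apply/matrixP=> i j; rewrite !mxE permE.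
by case: i => [[|[|[|[|//]]]] ?].
Qed.

Lemma eps_frame k D (m : {ffun 'I_k -> 'I_D}) (e : 'M[R]_D) mu nu rho sg :
  D = (k + 4)%N -> e \in unitmx ->
  \sum_a \sum_b \sum_c \sum_d
    eps m a b c d * e mu a * e nu b * e rho c * e sg d =
  \sum_(al : {ffun 'I_k -> 'I_D})
    eps al mu nu rho sg * (\det e * \prod_q invmx e (m q) (al q)).
Proof.
move=> E ue; subst D.
transitivity (det4 (select R m) (row mu e) (row nu e) (row rho e) (row sg e)).
  rewrite -det4_multilinear; do 4![apply: eq_bigr => ? _].
  by rewrite eps_det4 !mxE.
(* The last four rows are [e] applied to unit vectors, so [e] factors out on the right and leaves
   its inverse in the top rows. *)
have -> : det4 (select R m) (row mu e) (row nu e) (row rho e) (row sg e) =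
    det4 (select R m *m invmx e)
      (delta_mx 0 mu) (delta_mx 0 nu) (delta_mx 0 rho) (delta_mx 0 sg) * \det e.
  rewrite /det4 -det_mulmx mul_col_mx mulmxKV //; congr (\det (col_mx _ _)).
  apply/row_matrixP=> i; rewrite row_mul !rowK.
  by case: i => [[|[|[|[|//]]]] ?] /=; rewrite -rowE.
rewrite /det4 det_expand_top big_distrl; apply: eq_bigr => al _ /=.
rewrite eps_det4 -mulrA [_ * \det e]mulrC; congr (_ * (_ * _)).
apply: eq_bigr => q _; rewrite mxE (bigD1 (m q)) //= !mxE !eqxx mul1r.
by rewrite big1 ?addr0 // => j /negPf H; rewrite !mxE H andbF mul0r.
Qed.

Lemma sum_antisym_minor D (X : 'M[R]_D) p q : X^T = - X ->
  \sum_i \sum_j ((i == p)%:R * (j == q)%:R - (i == q)%:R * (j == p)%:R) * X i j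
  = 2 * X p q.
Proof.
move=> aX.
have pick a b : \sum_i \sum_j ((i == a)%:R * (j == b)%:R) * X i j = X a b.
  rewrite (bigD1 a) //= (bigD1 b) //= !eqxx !mul1r.
  rewrite big1 => [|j /negPf ->]; last by rewrite mulr0 mul0r.
  by rewrite addr0 big1 ?addr0 // => i /negPf ->; rewrite big1 // => j _; rewrite !mul0r.
under eq_bigr => i _ do (under eq_bigr => j _ do rewrite mulrBl; rewrite sumrB).
rewrite sumrB !pick; have := congr1 (fun M : 'M_D => M p q) aX.
by rewrite !mxE => ->; ring.
Qed.

(** Let m enumerate the complement of p, q, r, s. The product of the determinants is that of one
    matrix times the transpose of the other, which is block triangular with an identity block and
    the stated 4 x 4 block. *)
Lemma eps_mul_eps k D (p q r s : 'I_D) :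
  D = (k + 4)%N -> uniq [:: p; q; r; s] ->
  exists m : {ffun 'I_k -> 'I_D}, forall a b c d,
  eps m a b c d * eps m p q r s =
  \det (\matrix_(u < 4, v < 4) (nth a [:: a; b; c; d] u == nth p [:: p; q; r; s] v)%:R).
Proof.
move=> E U; subst D.
have cS : #|~: [set x in [:: p; q; r; s]]| = k.
  have := cardsC [set x in [:: p; q; r; s]].
  by rewrite cardsE (card_uniqP U) card_ord /=; lia.
pose m : {ffun 'I_k -> 'I_(k + 4)} := [ffun i => enum_val (cast_ord (esym cS) i)].
have m_inj i j : (m i == m j) = (i == j).
  by apply/eqP/eqP => [|->//]; rewrite !ffunE => /enum_val_inj/cast_ord_inj.
have m_out i : m i \notin [:: p; q; r; s].
  by have := enum_valP (cast_ord (esym cS) i); rewrite !inE ffunE.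
exists m => a b c d; rewrite !eps_det4 /det4.
rewrite -[X in _ * X]det_tr -det_mulmx tr_col_mx mul_col_row.
have -> : select R m *m (select R m)^T = 1%:M.
  apply/matrixP=> i j; rewrite !mxE (bigD1 (m i)) //= !mxE !eqxx mul1r m_inj.
  by rewrite big1 ?addr0 // => x /negPf H; rewrite !mxE H andbF mul0r.
have -> : select R m *m
    (row4 (delta_mx 0 p) (delta_mx 0 q) (delta_mx 0 r) (delta_mx 0 s))^T = 0.
  apply/matrixP=> i j; rewrite !mxE (bigD1 (m i)) //= !mxE !eqxx mul1r.
  rewrite big1 ?addr0 => [|x /negPf H]; last by rewrite !mxE H andbF mul0r.
  have := m_out i; rewrite !inE !negb_or =>
    /and4P[/negPf Hp /negPf Hq /negPf Hr /negPf Hs].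
  by case: j => [[|[|[|[|//]]]] ?] /=; rewrite mxE ?Hp ?Hq ?Hr ?Hs ?andbF.
rewrite det_lblock det1 mul1r; congr (\det _).
apply/matrixP=> i j; rewrite !mxE.
have E (x : seq 'I_(k + 4)) z y :
  (nth 0 (map (delta_mx 0 : _ -> 'rV[R]_(k + 4)) x) y) 0 z =
    ((y < size x)%N && (nth z x y == z))%:R.
  have [H|H] := ltnP y (size x); first by rewrite (nth_map z) // mxE eqxx eq_sym.
  by rewrite nth_default ?size_map // mxE.
rewrite (bigD1 (nth a [:: a; b; c; d] i)) //= !mxE.
rewrite !(E [:: a; b; c; d]) !(E [:: p; q; r; s]) /=.
rewrite !ltn_ord /= (set_nth_default a) // eqxx mul1r.
rewrite big1 ?addr0 => [|x H].
  by rewrite (set_nth_default p) // eq_sym.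
rewrite !mxE (E [:: a; b; c; d]) ltn_ord (set_nth_default a) //=.
by rewrite [nth _ _ _ == x]eq_sym (negPf H) mul0r.
Qed.

(** In the Laplace expansion of the 4 x 4 determinant of Kronecker deltas, each 2 x 2 minor
    contracts with X or Y to twice an entry; hence the factor 4. *)
Lemma eps_wedge k D (p q r s : 'I_D) :
  D = (k + 4)%N -> uniq [:: p; q; r; s] ->
  exists m : {ffun 'I_k -> 'I_D}, forall X Y : 'M[R]_D,
  X^T = - X -> Y^T = - Y ->
  eps m p q r s * (\sum_a \sum_b \sum_c \sum_d eps m a b c d * X a b * Y c d) =
  4 * wedge X Y (delta_mx 0 p) (delta_mx 0 q) (delta_mx 0 r) (delta_mx 0 s).
Proof.
move=> E U; have [m H] := eps_mul_eps E U; exists m => X Y aX aY.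
pose M (i j a b : 'I_D) : R := (a == i)%:R * (b == j)%:R - (a == j)%:R * (b == i)%:R.
have MM i j i' j' : \sum_a \sum_b \sum_c \sum_d M i j a b * M i' j' c d * X a b * Y c d
    = 4 * (X i j * Y i' j').
  transitivity ((\sum_a \sum_b M i j a b * X a b) * (\sum_c \sum_d M i' j' c d * Y c d)).
    rewrite big_distrl; apply: eq_bigr => a _; rewrite big_distrl.
    apply: eq_bigr => b _; rewrite big_distrr; apply: eq_bigr => c _.
    by rewrite big_distrr; apply: eq_bigr => d _ /=; ring.
  by rewrite !sum_antisym_minor //; ring.
transitivity (\sum_a \sum_b \sum_c \sum_d
   (M p q a b * M r s c d * X a b * Y c d
    - M p r a b * M q s c d * X a b * Y c d
    + M p s a b * M q r c d * X a b * Y c d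
    + M q r a b * M p s c d * X a b * Y c d
    - M q s a b * M p r c d * X a b * Y c d
    + M r s a b * M p q c d * X a b * Y c d)).
  rewrite big_distrr; apply: eq_bigr => a _; rewrite big_distrr; apply: eq_bigr => b _.
  rewrite big_distrr; apply: eq_bigr => c _; rewrite big_distrr; apply: eq_bigr => d _ /=.
  rewrite !mulrA [_ * eps m a b c d]mulrC H det_mx44 !mxE /= /M; ring.
under eq_bigr => a _ do (under eq_bigr => b _ do (under eq_bigr => c _ do
  (rewrite !(big_split, sumrN) /=); rewrite !(big_split, sumrN) /=);
  rewrite !(big_split, sumrN) /=).
rewrite !(big_split, sumrN) /= !MM /wedge !bil_delta; ring.
Qed.

(** This covers the index patterns excluded from [eps_wedge]: the product is alternating in its
    arguments. *)
Lemma wedge_repeat D (X Y : 'M[R]_D) (p q r s : 'I_D) :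
  X^T = - X -> Y^T = - Y -> ~~ uniq [:: p; q; r; s] ->
  wedge X Y (delta_mx 0 p) (delta_mx 0 q) (delta_mx 0 r) (delta_mx 0 s) = 0.
Proof.
move=> aX aY; rewrite /wedge !bil_delta.
have XC i j : X i j = - X j i by have := congr1 (fun M : 'M_D => M j i) aX; rewrite !mxE.
have YC i j : Y i j = - Y j i by have := congr1 (fun M : 'M_D => M j i) aY; rewrite !mxE.
have Xi i : X i i = 0 by have := XC i i; lra.
have Yi i : Y i i = 0 by have := YC i i; lra.
move=> U; have : [|| p == q, p == r, p == s, q == r, q == s | r == s].
  by move: U; rewrite /= !inE; do 6![case: (_ == _)].
case/or4P=> [||| /or3P[]] /eqP E; rewrite {}E.
- by rewrite !Xi !Yi; ring.
- by rewrite !Xi !Yi (XC q r) (YC q r); ring.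
- by rewrite !Xi !Yi (XC q s) (YC q s) (XC r s) (YC r s); ring.
- by rewrite !Xi !Yi; ring.
- by rewrite !Xi !Yi (XC r s) (YC r s); ring.
- by rewrite !Xi !Yi; ring.
Qed.

End Epsilon.

(** * Consequences of genericity, rescaling, and the equivalence *)

Lemma Bmap_sum (R : realType) D (B : 'I_D -> 'I_D -> 'I_D -> 'I_D -> R) th :
  Bmap B th = \sum_mu \sum_nu th mu nu *: \matrix_(i, j) B mu nu i j.
Proof.
apply/matrixP=> i j; rewrite mxE summxE; apply: eq_bigr => mu _.
by rewrite summxE; apply: eq_bigr => nu _; rewrite !mxE mulrC.
Qed.

Lemma generic_inj (R : realType) D (B : 'I_D -> 'I_D -> 'I_D -> 'I_D -> R) th :
  generic B -> th^T = - th -> Bmap B th = 0 -> th = 0.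
Proof.
move=> gB ath E; have [|th0 [_ U]] := gB 0; first by rewrite /antisym trmx0 oppr0.
rewrite -(U th) ?(U 0) //; split; rewrite /antisym ?trmx0 ?oppr0 //.
by rewrite Bmap_sum big1 // => i _; rewrite big1 // => j _; rewrite mxE scale0r.
Qed.

Lemma exists_root (R : rcfType) n (a : R) :
  0 < a -> exists2 t, 0 < t & t ^+ n.+1 = a.
Proof.
(* The bound 1 + a works because its powers with positive exponent are at least 1 + a, which exceeds
   a. *)
move=> a0; have : exists2 t, 0 <= t <= 1 + a & root ('X^(n.+1) - a%:P) t.
  apply: poly_ivt; first by lra.
  rewrite !hornerE expr0n /= sub0r oppr_le0 ltW //=.
  rewrite subr_ge0 (le_trans (y := 1 + a)) ?lerDr //.
  by rewrite -[leLHS]expr1 ler_weXn2l // lerDl ltW.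
case=> t /andP[t0 _] /rootP.
rewrite !hornerE => /eqP; rewrite subr_eq0 => /eqP E; exists t => //.
rewrite lt_def t0 andbT; apply: contraTneq a0 => t00.
by rewrite -E t00 expr0n ltxx.
Qed.

Lemma rescale_frame (R : realType) D (H : 'M[R]_D) (k : R) :
  H \in unitmx -> k != 0 -> exists (e : 'M[R]_D) (b : bool),
  forall mu nu, k *: skew_mx (row mu H) (row nu H) =
    ((-1) ^+ b * `|\det e| / 2) *: skew_mx (row mu e) (row nu e).
Proof.
rewrite unitmxE unitfE => dH k0.
(* For e = tH the determinant contributes t^D and the two rows t^2, so t must be a root of order D +
   2; the sign of k becomes b. *)
have [|t t0 tE] := @exists_root R D.+1 (2 * `|k| / `|\det H|).
  by rewrite divr_gt0 ?mulr_gt0 ?normr_gt0.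
exists (t *: H), (k < 0) => mu nu.
rewrite !linearZ /= skew_mxZl skew_mxZr !scalerA; congr (_ *: _).
rewrite detZ normrM normrX (gtr0_norm t0).
transitivity ((-1) ^+ (k < 0)%R * (t ^+ D.+2 * `|\det H| / 2)); last first.
  by rewrite !exprS; field.
rewrite tE divfK ?normr_eq0 // [2 * _]mulrC mulfK ?pnatr_eq0 //.
exact: numEsign.
Qed.

(** If det e = 0, the prefactor makes B vanish, and B would send the nonzero e_p /\ e_q to 0. *)
Lemma generic_frame_unit (R : realType) D (B : 'I_D -> 'I_D -> 'I_D -> 'I_D -> R)
    (s : R) (e : 'M[R]_D) :
  (1 < D)%N -> generic B ->
  (forall mu nu i j, B mu nu i j =
    s * `|\det e| * ((e mu i * e nu j - e nu i * e mu j) / 2)) ->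
  e \in unitmx.
Proof.
move=> D1 gB BE; rewrite unitmxE unitfE; apply/negP => /eqP e0.
have [p _] := @exists_notin _ [::] (ltnW D1).
have [q] := @exists_notin _ [:: p] D1; rewrite inE => qp.
have := @generic_inj _ _ B (skew_mx (delta_mx 0 p) (delta_mx 0 q)) gB (tr_skew_mx _ _).
rewrite Bmap_sum big1 => [/(_ erefl)|mu _]; last first.
  rewrite big1 // => nu _; have -> : \matrix_(i, j) B mu nu i j = 0.
    by apply/matrixP=> i j; rewrite !mxE BE e0 normr0 mulr0 mul0r.
  by rewrite scaler0.
move/(congr1 (fun M : 'M_D => M p q))/eqP.
by rewrite skew_mxE !mxE !eqxx (eq_sym p) (negPf qp) mulr0 subr0 mulr1 oner_eq0.
Qed.

Theorem theorem1 (R : realType) (D : nat) (hD : (4 < D)%N)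
  (B : 'I_D -> 'I_D -> 'I_D -> 'I_D -> R)
  (hBmn : forall mu nu i j, B mu nu i j = - B nu mu i j)
  (hBij : forall mu nu i j, B mu nu i j = - B mu nu j i)
  (hgen : generic B) :
  (exists c : {ffun 'I_(D - 4) -> 'I_D} -> {ffun 'I_(D - 4) -> 'I_D} -> R,
     forall (m : {ffun 'I_(D - 4) -> 'I_D}) (mu nu rho sg : 'I_D),
       \sum_(i < D) \sum_(j < D) \sum_(k < D) \sum_(l < D)
          levi4 R m i j k l * B mu nu i j * B rho sg k l
       = \sum_(al : {ffun 'I_(D - 4) -> 'I_D}) levi4 R al mu nu rho sg * c m al)
  <->
  (exists (e : 'M[R]_D) (b : bool),
     forall mu nu i j,
       B mu nu i j
       = (-1) ^+ b * `|\det e| * ((e mu i * e nu j - e nu i * e mu j) / 2)).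
Proof.
have DE : D = (D - 4 + 4)%N by rewrite subnK // ltnW.
have levi4E m a b c d : levi4 R m a b c d = eps R m a b c d by [].
split=> [[c Hc]|[e [b He]]]; last first.
  have ue := generic_frame_unit (ltn_trans (isT : 1 < 4)%N hD) hgen He.
  (* The coefficients of [eps_frame], times the square of the prefactor [|det e|] in B. *)
  exists (fun m al => (\det e) ^+ 2 *
    (\det e * \prod_q invmx e (m q) (al q))) => m mu nu rho sg.
  pose G x y z w := \sum_(al : {ffun 'I_(D - 4) -> 'I_D})
    eps R al x y z w * (\det e * \prod_q invmx e (m q) (al q)).
  have G01 x y z w : G y x z w = - G x y z w.
    by rewrite -sumrN; apply: eq_bigr => al _; rewrite eps_swap01 // mulNr.
  have G23 x y z w : G x y w z = - G x y z w.
    by rewrite -sumrN; apply: eq_bigr => al _; rewrite eps_swap23 // mulNr.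
  have GE x y z w := @eps_frame R _ D m e x y z w DE ue.
  transitivity ((\det e) ^+ 2 * G mu nu rho sg); last first.
    by rewrite big_distrr; apply: eq_bigr => al _ /=; rewrite levi4E mulrCA.
  pose S x y z w := \sum_i \sum_j \sum_k \sum_l
    eps R m i j k l * e x i * e y j * e z k * e w l.
  have SE x y z w : S x y z w = G x y z w by apply: GE.
  (* The two brackets expand into four terms, which antisymmetry of epsilon makes equal; this
     cancels the 1/4. *)
  transitivity (((-1) ^+ b * `|\det e|) ^+ 2 / 4 *
     (S mu nu rho sg - S nu mu rho sg - S mu nu sg rho + S nu mu sg rho)).
    rewrite -!sumrN -!big_split big_distrr; apply: eq_bigr => i _ /=.
    rewrite -!sumrN -!big_split big_distrr; apply: eq_bigr => j _ /=.
    rewrite -!sumrN -!big_split big_distrr; apply: eq_bigr => k _ /=.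
    rewrite -!sumrN -!big_split big_distrr; apply: eq_bigr => l _ /=.
    rewrite !He levi4E; set s := _ * `| _ |.
    by field.
  rewrite !SE (G01 mu nu) (G23 mu nu) (G01 mu nu sg) (G23 mu nu).
  rewrite exprMn sqrr_sign mul1r real_normK ?num_real //.
  by field.
pose Bm mu nu := \matrix_(i, j) B mu nu i j.
have aB mu nu : (Bm mu nu)^T = - Bm mu nu.
  by apply/matrixP=> i j; rewrite !mxE hBij.
have BC mu nu : Bm mu nu = - Bm nu mu.
  by apply/matrixP=> i j; rewrite !mxE hBmn.
have wedgeB mu nu rho sg x y z w :
    wedge (Bm mu nu) (Bm rho sg) x y z w + wedge (Bm mu rho) (Bm nu sg) x y z w = 0.
  apply: wedge_eq0_ext => p q r s.
  have [U|U] := boolP (uniq [:: p; q; r; s]); last first.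
    by rewrite !wedge_repeat // addr0.
  have [m Hm] := eps_wedge R DE U.
  have sumE a b c' d : \sum_i \sum_j \sum_k \sum_l
      eps R m i j k l * Bm a b i j * Bm c' d k l = \sum_al levi4 R al a b c' d * c m al.
    by rewrite -Hc; do 4![apply: eq_bigr => ? _]; rewrite !mxE.
  apply: (mulfI (_ : 4 != 0 :> R)); first by rewrite pnatr_eq0.
  (* By (1) both products become sums over the same coefficients [c m al], with epsilon symbols of
     opposite sign since nu and rho are exchanged. *)
  rewrite mulr0 mulrDr -!Hm // !sumE -mulrDr -big_split big1 ?mulr0 // => al _ /=.
  by rewrite !levi4E [eps R al mu rho nu sg]eps_swap12 // mulNr subrr.
have injB (th : 'M[R]_D) : th^T = - th ->
    \sum_mu \sum_nu th mu nu *: Bm mu nu = 0 -> th = 0.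
  by rewrite -Bmap_sum; apply: generic_inj.
have surjB (phi : 'M[R]_D) : phi^T = - phi ->
    exists th : 'M[R]_D, \sum_mu \sum_nu th mu nu *: Bm mu nu = phi.
  by move=> /hgen[th [[_ E] _]]; exists th; rewrite -Bmap_sum.
have [H [k [uH k0 BE]]] := frame_exists hD aB BC wedgeB injB surjB.
have [e [b eE]] := rescale_frame uH k0; exists e, b => mu nu i j.
have := congr1 (fun M : 'M_D => M i j) (BE mu nu).
rewrite eE [LHS]mxE => ->; rewrite mxE skew_mxE !mxE.
by rewrite -!mulrA; congr (_ * (_ * _)); rewrite mulrC.
Qed.
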